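(* Let $m\ge 4$ be an even integer and let $\theta\in(0,1]$. For $\nu>0$ let $$M=M(\nu)=(I-\theta\nu L)^{-1}\bigl(I+(1-\theta)\nu L\bigr)\in\mathbb{R}^{m\times m}$$ be the matrix of the iteration $u^{n+1}=Mu^n$ obtained by discretizing the advection equation $U_t=aU_x$ ($a>0$) on $[0,1]$ with periodic boundary condition by the Fourier spectral collocation method in space with $m$ spatial grid points and the $\theta$-method in time, where $\nu=a\,\Delta t/\Delta x$ is the CFL number. Then there exists $\nu_0>0$ such that the matrix $M$ has at least one negative entry for any $\nu>\nu_0$.
   Context: For even $m$, the Fourier spectral collocation matrix $L\in\mathbb{R}^{m\times m}$ is given by $L_{i,i}=0$ and $L_{i,j}=\frac{\pi}{m}(-1)^{i+j}\cot\left(\frac{(i-j)\pi}{m}\right)$ for $i\ne j$ ($1\le i,j\le m$). $\Delta x=1/m$ and $\Delta t>0$ are the spatial and temporal step sizes. The $\theta$-method applied to $u'=\frac{a}{\Delta x}Lu$ is $u^{n+1}=u^n+\nu\bigl((1-\theta)Lu^n+\theta Lu^{n+1}\bigr)$. $I$ is the identity matrix. *)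

(* Defs.v *)
(* MathComp world: real analysis over an abstract [R : realType]. *)
From HB Require Import structures.
From mathcomp Require Import all_boot all_order all_algebra.
From mathcomp Require Import reals trigo.

Set Implicit Arguments.
Unset Strict Implicit.
Unset Printing Implicit Defensive.

Import Order.TTheory GRing.Theory Num.Theory.
Local Open Scope ring_scope.

Definition cot (R : realType) (x : R) : R := cos x / sin x.

(* Indices run over 0, ..., m-1 instead of 1, ..., m; the entries depend only
   on i - j and on the parity of i + j, so the matrix is the same.  The
   difference i - j is taken in R, not as a truncated subtraction. *)
Definition fourier_mx (R : realType) (m : nat) : 'M[R]_m :=
  \matrix_(i, j)
    if i == j then 0
    else pi / m%:R * (-1) ^+ (i + j) * cot ((i%:R - j%:R) * pi / m%:R).

(* One step of the theta-method for u' = (a / dx) L u, with nu = a dt / dx. *)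
Definition theta_step (R : realType) (m : nat) (theta nu : R)
    (u u' : 'cV[R]_m) : Prop :=
  u' = u + nu *: ((1 - theta) *: (fourier_mx R m *m u)
                  + theta *: (fourier_mx R m *m u')).

Definition theta_mx (R : realType) (m : nat) (theta nu : R) : 'M[R]_m :=
  invmx (1%:M - (theta * nu) *: fourier_mx R m)
    *m (1%:M + ((1 - theta) * nu) *: fourier_mx R m).

Lemma fourier_mx_skew (R : realType) (m : nat) :
  (fourier_mx R m)^T = - fourier_mx R m.
Proof.
apply/matrixP => i j; rewrite !mxE eq_sym; case: eqP => _; first by rewrite oppr0.
by rewrite addnC -(opprB i%:R) !mulNr /cot cosN sinN invrN mulrN mulrN.
Qed.

(* [invmx A] is [A] itself when A is singular; this never happens in
   [theta_mx], so there [invmx] is a genuine inverse. *)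
Lemma theta_mx_unit (R : realType) (m : nat) (c : R) :
  1%:M - c *: fourier_mx R m \in unitmx.
Proof.
rewrite -row_free_unit; apply: inj_row_free => v.
rewrite mulmxBr mulmx1 => /eqP; rewrite subr_eq0 => /eqP vE.
set L := fourier_mx R m in vE.
have sk : v *m L *m v^T = - (v *m L *m v^T).
  have tr11 (X : 'M[R]_1) : X^T = X by apply/matrixP => i j; rewrite mxE !ord1.
  rewrite -{1}[LHS]tr11 !trmx_mul trmxK fourier_mx_skew.
  by rewrite mulNmx mulmxN mulmxA.
have z : v *m L *m v^T = 0.
  apply/matrixP => i j; move/matrixP: sk => /(_ i j); rewrite !mxE => /eqP.
  by rewrite -subr_eq0 opprK -mulr2n mulrn_eq0 /= => /eqP.
have vv : v *m v^T = 0 by rewrite {1}vE -scalemxAr -scalemxAl z scaler0.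
apply/rowP => k; rewrite mxE.
move/matrixP: vv => /(_ 0 0); rewrite !mxE => /eqP.
rewrite psumr_eq0 => [|j _]; last by rewrite mxE -expr2 sqr_ge0.
by move=> /allP/(_ k (mem_index_enum k)); rewrite mxE mulf_eq0 orbb => /eqP.
Qed.

Lemma theta_stepP (R : realType) (m : nat) (theta nu : R) (u u' : 'cV[R]_m) :
  theta_step theta nu u u' <-> u' = theta_mx m theta nu *m u.
Proof.
rewrite /theta_step /theta_mx; set L := fourier_mx R m.
set A := 1%:M - _; set B := 1%:M + _.
have uA : A \in unitmx by exact: theta_mx_unit.
have -> : (u' = u + nu *: ((1 - theta) *: (L *m u) + theta *: (L *m u')))
          <-> A *m u' = B *m u.
  rewrite /A /B mulmxBl mulmxDl !mul1mx -!scalemxAl scalerDr !scalerA.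
  rewrite ![nu * _]mulrC addrA.
  by split=> [E|/eqP]; [rewrite {1}E addrK | rewrite subr_eq => /eqP].
by split=> [E|->]; [rewrite -mulmxA -E mulKmx | rewrite -mulmxA mulKVmx].
Qed.

(* Main.v *)
Require Import Defs.
From mathcomp Require Import all_boot all_order all_algebra.
From mathcomp Require Import reals.
From mathcomp Require Import trigo.

Import Order.TTheory GRing.Theory Num.Theory.
Local Open Scope ring_scope.

(** The claim holds for every positive CFL number, with no asymptotics in [nu].

    For even [m] the matrix [L] kills both the constant vector and the
    sawtooth vector [(-1) ^+ j]: the sawtooth is the Nyquist mode, whose spectral
    derivative vanishes at the grid points ([sum_fourier_mx]).  Hence one step of the
    theta-method leaves both vectors unchanged ([theta_mx_fix]), that is,
    for each row [i] of [M],
      sum_j M i j = 1   and   sum_j (-1) ^+ (i + j) * M i j = 1.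
    The difference of the two identities says that the entries of row [i] with
    [i + j] odd sum to 0.  If [M] had no negative entry, all of these entries
    would vanish ([nonneg_checkerboard]), so [M] would commute with the
    diagonal matrix of the signs [(-1) ^+ j] ([sign_mx_commP]).  As [theta M + (1 - theta) I] is
    the inverse of [I - theta nu L], the matrix [L] would commute with the
    signs too ([theta_mx_comm]), so that its entries with [i + j] odd would
    also vanish.  But the entry of [L] in position (0, 1) is
    [pi / m * cot (pi / m)], which is positive since [m > 2]. *)

Section Cotangent.

Variable R : realType.
Implicit Types x : R.

Lemma cotN x : cot (- x) = - cot x.
Proof. by rewrite /cot cosN sinN invrN mulrN. Qed.

Lemma cotDnpi x n : cot (x + n%:R * pi) = cot x.
Proof.
elim: n => [|n IHn]; first by rewrite mul0r addr0.
rewrite -natr1 mulrDl mul1r addrA -[RHS]IHn /cot cosDpi sinDpi.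
by rewrite invrN mulrNN.
Qed.

Lemma cot_eqmod (m a b : nat) x : (0 < m)%N -> a = b %[mod m] ->
  cot (x + (a%:R - b%:R) * pi / m%:R) = cot x.
Proof.
move=> m_gt0 eq_ab; have m_neq0 : m%:R != 0 :> R by rewrite pnatr_eq0 -lt0n.
rewrite (divn_eq a m) (divn_eq b m) eq_ab !natrD !natrM.
rewrite opprD addrACA subrr addr0 -mulrBl.
rewrite -!mulrA [m%:R * _]mulrCA divff // mulr1 mulrBl addrA.
by rewrite -[LHS](cotDnpi _ (b %/ m)) subrK cotDnpi.
Qed.

End Cotangent.

Section FourierMatrix.

Variable R : realType.

(** At [i = j] the formula gives [cos 0 / sin 0 = 1 / 0 = 0]. *)
Lemma fourier_mxE m (i j : 'I_m) :
  fourier_mx R m i j =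
    pi / m%:R * (-1) ^+ (i + j) * cot ((i%:R - j%:R) * pi / m%:R).
Proof.
rewrite mxE; case: eqP => // ->.
by rewrite subrr !mul0r /cot sin0 invr0 !mulr0.
Qed.

(** The reflection [j |-> 2 i - j] about [i] modulo [m] changes the sign of the
    cotangent and, [m] being even, preserves the parity of [j]; so the sum is
    equal to its opposite. *)
Lemma sum_fourier_mx m (e : R) (i : 'I_m) : ~~ odd m -> e ^+ 2 = 1 ->
  \sum_j fourier_mx R m i j * e ^+ j = 0.
Proof.
case: m i => [[] //|n] i m_even e2.
have expe (x : R) k l : x ^+ 2 = 1 -> odd k = odd l -> x ^+ k = x ^+ l.
  move=> x2 kl; rewrite -(odd_double_half k) -(odd_double_half l) kl.
  by rewrite !exprD -!mul2n !exprM x2 !expr1n.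
set S := LHS; suff /eqP : S = - S.
  by rewrite -addr_eq0 -mulr2n mulrn_eq0 => /eqP.
rewrite {1}/S (reindex_inj (@subrI _ (i + i))) -sumrN.
apply: eq_bigr => j _; set k := i + i - j.
have kj : (i + i = k + j %[mod n.+1])%N.
  by have /(congr1 val) : i + i = k + j by rewrite subrK.
clearbody k.
have odd_k : odd k = odd j.
  have oddm (a : nat) : odd (a %% n.+1) = odd a.
    by rewrite [in RHS](divn_eq a n.+1) oddD oddM (negPf m_even) andbF.
  have := congr1 odd kj; rewrite !oddm !oddD addbb.
  by case: (odd k); case: (odd j).
rewrite !fourier_mxE (expe e _ _ e2 odd_k) (expe (-1) (i + k)%N (i + j)%N).
- have -> : (i%:R - k%:R) * pi / n.+1%:R =
    - ((i%:R - j%:R) * pi / n.+1%:R) +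
      ((i + i)%N%:R - (k + j)%N%:R) * pi / n.+1%:R :> R.
    rewrite -!mulNr -!mulrDl !natrD; congr (_ * _ * _).
    by rewrite opprB opprD [i%:R + _ + _]addrACA [RHS]addrCA subrKA subrr addr0.
  by rewrite cot_eqmod // cotN mulrN mulNr.
- by rewrite sqrrN expr1n.
- by rewrite !oddD odd_k.
Qed.

Lemma fourier_mx01_neq0 m (i j : 'I_m) :
  (2 < m)%N -> i = 0%N :> nat -> j = 1%N :> nat -> fourier_mx R m i j != 0.
Proof.
move=> m_gt2 i0 j1; rewrite fourier_mxE i0 j1 sub0r mulNr mul1r mulNr cotN.
have m_gt0 : 0 < m%:R :> R by rewrite ltr0n ltnW // ltnW.
have x_gt0 : 0 < pi / m%:R :> R by rewrite divr_gt0 ?pi_gt0.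
have x_lt : pi / m%:R < pi / 2 :> R.
  by rewrite ltr_pM2l ?pi_gt0 // ltf_pV2 ?posrE // ltr_nat.
have c_gt0 : 0 < cos (pi / m%:R) :> R.
  apply: cos_gt0_pihalf; rewrite x_lt (lt_trans _ x_gt0) //.
  by rewrite oppr_lt0 divr_gt0 ?pi_gt0.
have s_gt0 : 0 < sin (pi / m%:R) :> R.
  apply: sin_gt0_pi; rewrite x_gt0 (lt_trans x_lt) //.
  by rewrite ltr_pdivrMr // ltr_pMr ?pi_gt0 // ltr1n.
by rewrite add0n expr1 mulrN1 mulrNN gt_eqF // mulr_gt0 // /cot divr_gt0.
Qed.

End FourierMatrix.

Definition sign_mx (R : pzRingType) m : 'M[R]_m := diag_mx (\row_j (-1) ^+ j).

(** In position [(i, j)] the two products are [(-1) ^+ i * A i j] and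
    [A i j * (-1) ^+ j]. *)
Lemma sign_mx_commP (R : realDomainType) m (A : 'M[R]_m) :
  sign_mx R m *m A = A *m sign_mx R m <->
  (forall i j : 'I_m, odd (i + j) -> A i j = 0).
Proof.
rewrite mul_diag_mx mul_mx_diag; split=> [/matrixP DA i j | A_odd].
  have := DA i j; rewrite !mxE -signr_odd -(signr_odd _ j) oddD mulrC.
  case: (odd i); case: (odd j) => //=; rewrite expr1 expr0 mulrN mulr1 => /eqP.
    by rewrite eq_sym -addr_eq0 -mulr2n mulrn_eq0 => /eqP.
  by rewrite -addr_eq0 -mulr2n mulrn_eq0 => /eqP.
apply/matrixP => i j; rewrite !mxE mulrC -signr_odd -(signr_odd _ j).
have [ij_odd|] := boolP (odd (i + j)); first by rewrite A_odd // !mul0r.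
by rewrite oddD; case: (odd i); case: (odd j).
Qed.

(** Row [i] contributes [1 - (-1) ^+ (i + j)] times its entry [j], which is
    nonnegative, and these terms sum to [1 - 1 = 0]. *)
Lemma nonneg_checkerboard (R : realDomainType) m (M : 'M[R]_m) :
    (forall i j, 0 <= M i j) ->
    (forall i, \sum_j M i j = 1) ->
    (forall i, \sum_j M i j * (-1) ^+ j = (-1) ^+ i) ->
  forall i j : 'I_m, odd (i + j) -> M i j = 0.
Proof.
move=> M_ge0 sum1 sumN1 i j ij_odd.
have term_ge0 (k : 'I_m) : true -> 0 <= M i k * (1 - (-1) ^+ (i + k)).
  move=> _; rewrite mulr_ge0 // -signr_odd.
  by case: (odd _); rewrite ?expr1 ?opprK ?expr0 ?subrr ?addr_ge0 ?ler01.
have : \sum_k M i k * (1 - (-1) ^+ (i + k)) = 0.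
  under eq_bigr => k _ do rewrite mulrBr mulr1 exprD mulrCA.
  by rewrite sumrB -mulr_sumr sum1 sumN1 -expr2 sqrr_sign subrr.
move/eqP; rewrite psumr_eq0 // => /allP/(_ j (mem_index_enum j)) /=.
rewrite -signr_odd ij_odd expr1 opprK mulf_eq0 -mulr2n pnatr_eq0 orbF.
by move/eqP.
Qed.

Section ThetaMatrix.

Variables (R : realType) (m : nat).
Implicit Types theta nu : R.

Lemma theta_mx_fix theta nu (u : 'cV[R]_m) :
  fourier_mx R m *m u = 0 -> theta_mx m theta nu *m u = u.
Proof.
move=> Lu; apply/esym/theta_stepP.
by rewrite /theta_step Lu !scaler0 addr0 scaler0 addr0.
Qed.

Lemma sum_theta_mx theta nu (e : R) (i : 'I_m) : ~~ odd m -> e ^+ 2 = 1 ->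
  \sum_j theta_mx m theta nu i j * e ^+ j = e ^+ i.
Proof.
move=> m_even e2; pose u : 'cV[R]_m := \col_j e ^+ j.
have /(theta_mx_fix theta nu)/colP/(_ i) : fourier_mx R m *m u = 0.
  apply/colP => k; rewrite !mxE -[RHS](@sum_fourier_mx R m e k) //.
  by apply: eq_bigr => j _; rewrite [u _ _]mxE.
by rewrite !mxE => <-; apply: eq_bigr => j _; rewrite [u _ _]mxE.
Qed.

(** With [A = I - theta nu L] and [B = I + (1 - theta) nu L] we have
    [theta B + (1 - theta) A = I], and [M] is [A^-1 B]. *)
Lemma theta_mx_resolvent theta nu :
  (1%:M - (theta * nu) *: fourier_mx R m)
    *m (theta *: theta_mx m theta nu + (1 - theta)%:M) = 1%:M.
Proof.
rewrite mulmxDr -scalemxAr /theta_mx mulKVmx ?theta_mx_unit //.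
rewrite mul_mx_scalar scalerDr scalerBr !scalerA mulrA.
rewrite [theta * (1 - theta)]mulrC -mulrA addrACA subrr addr0.
by rewrite -scalerDl subrKC scale1r.
Qed.

(** A matrix that commutes with [theta M + (1 - theta) I] commutes with its
    inverse, from which [L] is recovered since [theta nu] is nonzero. *)
Lemma theta_mx_comm theta nu (D : 'M[R]_m) : theta * nu != 0 ->
  D *m theta_mx m theta nu = theta_mx m theta nu *m D ->
  D *m fourier_mx R m = fourier_mx R m *m D.
Proof.
move=> c_neq0 DM; have AN := theta_mx_resolvent theta nu.
set A := (X in X *m _ = _) in AN; set N := (X in _ *m X = _) in AN.
have NA := mulmx1C AN.
have DN : D *m N = N *m D.
  rewrite /N mulmxDr mulmxDl -scalemxAr -scalemxAl DM.
  by rewrite mul_mx_scalar mul_scalar_mx.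
have DA : D *m A = A *m D.
  rewrite -[LHS]mul1mx -AN -[A *m N *m _]mulmxA [N *m _]mulmxA -DN.
  by rewrite -[D *m N *m A]mulmxA NA mulmx1.
move: DA; rewrite /A mulmxBr mulmxBl mulmx1 mul1mx => /addrI/oppr_inj.
by rewrite -scalemxAr -scalemxAl => /(scalerI c_neq0).
Qed.

End ThetaMatrix.

Theorem proposition2 (R : realType) (m : nat) (theta : R)
    (hm : (4 <= m)%N) (m_even : ~~ odd m) (htheta : 0 < theta <= 1) :
  exists2 nu0 : R, 0 < nu0 &
    forall nu : R, nu0 < nu -> exists i j : 'I_m, theta_mx m theta nu i j < 0.
Proof.
(* Every positive number would do for [nu0]. *)
exists 1 => // nu nu_gt1; case/andP: htheta => theta_gt0 _.
set M := theta_mx m theta nu.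
suff /existsP[i /existsP[j ltM]] : [exists i, exists j, M i j < 0].
  by exists i, j.
apply: contraT => /existsPn nltM.
have M_ge0 i j : 0 <= M i j.
  by rewrite leNgt; apply: contra (nltM i) => ?; apply/existsP; exists j.
have M_odd (i j : 'I_m) : odd (i + j) -> M i j = 0.
  apply: nonneg_checkerboard => // k; last first.
    by rewrite sum_theta_mx // sqrrN expr1n.
  rewrite -[RHS](expr1n _ k) -(@sum_theta_mx _ _ theta nu) ?expr1n //.
  by apply: eq_bigr => l _; rewrite expr1n mulr1.
have c_neq0 : theta * nu != 0.
  by rewrite mulf_neq0 ?gt_eqF // (lt_trans _ nu_gt1).
have /sign_mx_commP L_odd :=
  theta_mx_comm _ _ _ _ _ c_neq0 ((sign_mx_commP _ _ _).2 M_odd).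
have m_gt2 : (2 < m)%N by apply: ltnW.
pose i0 : 'I_m := Ordinal (ltnW (ltnW m_gt2)).
pose i1 : 'I_m := Ordinal (ltnW m_gt2).
by case/eqP: (fourier_mx01_neq0 R m i0 i1 m_gt2 erefl erefl); apply: L_odd.
Qed.
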